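(* Let $X,Y$ be real Banach spaces and let $f\in C^1(X;Y)$. Assume: (i) $f'(x)\in\mathrm{Isom}(X;Y)$ for every $x\in X$; (ii) $\sup_{\|x\|\le r}\|f'(x)^{-1}\|<+\infty$ for every $r$ with $0<r<+\infty$; (iii) there exists a locally Lipschitz continuous coercive function $k:X\to\mathbb{R}_+$ which admits all right directional derivatives $D^+_v k(x)$ ($x,v\in X$), such that $$\sup\bigl\{D^+_v k(x): v=f'(x)^{-1}u,\ x\in X,\ u\in Y,\ \|u\|=1\bigr\}<+\infty.$$ Then $f$ is a global diffeomorphism of $X$ onto $Y$. When $k\in C^1$, condition (iii) is equivalent to $\sup_{x\in X}\|k'(x)\circ f'(x)^{-1}\|<+\infty$.
   Context: $\mathrm{Isom}(X;Y)$ denotes the set of bounded linear isomorphisms from $X$ onto $Y$. $\mathbb{R}_+=[0,+\infty)$. A function $k:X\to\mathbb{R}_+$ is coercive if it is continuous and $k(x)\to+\infty$ as $\|x\|\to+\infty$. The right directional derivative is $D^+_v k(x):=\lim_{s\to0^+}\frac{k(x+sv)-k(x)}{s}$. *)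

(* Defs.v *)
From HB Require Import structures.
From mathcomp Require Import all_boot all_order all_algebra.
From mathcomp Require Import all_classical all_reals all_analysis.
Set Implicit Arguments. Unset Strict Implicit. Unset Printing Implicit Defensive.
Import Order.TTheory GRing.Theory Num.Theory.
Import numFieldNormedType.Exports.
Local Open Scope ring_scope.
Local Open Scope classical_set_scope.

Section Defs.
Context {R : realType}.

(* f is C^1: Frechet differentiable everywhere, and x |-> f'(x) is
   continuous for the operator norm (operator norm bound written out). *)
Definition C1 {V W : normedModType R} (f : V -> W) : Prop :=
  (forall x, differentiable f x) /\
  (forall x (e : R), 0 < e -> exists d : R, 0 < d /\
     forall z, `|z - x| < d -> forall h, `|'d f z h - 'd f x h| <= e * `|h|).

Definition global_diffeo {V W : normedModType R} (f : V -> W) : Prop :=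
  C1 f /\ exists h : W -> V, cancel f h /\ cancel h f /\ C1 h.

Definition rdq {V : normedModType R} (k : V -> R) (x v : V) : R -> R :=
  fun s => (k (x + s *: v) - k x) / s.

Definition has_rdd {V : normedModType R} (k : V -> R) (x v : V) : Prop :=
  exists l : R, rdq k x v @ 0^'+ --> l.

Definition rdd {V : normedModType R} (k : V -> R) (x v : V) : R :=
  lim (rdq k x v @ 0^'+).

Definition locally_lipschitz {V : normedModType R} (k : V -> R) : Prop :=
  forall x, exists d L : R, 0 < d /\
    forall y z, `|y - x| < d -> `|z - x| < d -> `|k y - k z| <= L * `|y - z|.

Definition coercive {V : normedModType R} (k : V -> R) : Prop :=
  continuous k /\ forall M : R, exists r : R, forall x, r <= `|x| -> M <= k x.

End Defs.

(* Main.v *)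
Require Import Defs.
From HB Require Import structures.
From mathcomp Require Import all_boot all_order all_algebra.
From mathcomp Require Import all_classical all_reals all_analysis.
From mathcomp Require Import lra ring.
Import Order.TTheory GRing.Theory Num.Theory.
Import numFieldNormedType.Exports.
Local Open Scope ring_scope.
Local Open Scope classical_set_scope.

(* Fix a point a. For y in Y, lift the segment from f a to y through the local
   diffeomorphism f to a path p starting at a. Such a path has velocity
   f'(p)^-1 (y - f a), so by (iii) k grows at most linearly along p; coercivity
   keeps p in a ball, where (ii) bounds the velocity, so p is Lipschitz and can
   be continued up to time 1. Its end point sigma y depends continuously on y
   and f (sigma y) = y. Conversely, t |-> sigma (f (a + t (x - a))) and
   t |-> a + t (x - a) are lifts of the same path with the same origin, so
   sigma (f x) = x. *)

Set Implicit Arguments.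
Unset Strict Implicit.
Unset Printing Implicit Defensive.

(** A lift solves p' = f'(p)^-1 w, but this vector field is only continuous, and on an
    infinite-dimensional Banach space a continuous field may have no integral curve, or several.
    Existence and uniqueness of lifts are therefore drawn from f itself, which near each point is
    injective with a Lipschitz inverse; the velocity enters only as a first-order estimate to the
    right of each time. Such one-sided estimates are all that (iii) can feed, since k has only right
    directional derivatives, and [dini_growth] integrates them. Every passage from local to global
    is a [real_induction] on time: its right step uses the local inverse, its left step continuity
    or completeness. *)

(** * Induction along a real interval and integration of one-sided estimates *)

(** Let [c] be the supremum of the times up to which [P] holds throughout. The left hypothesis gives
    [P c]; the right one would push beyond [c] if [c < b]. *)
Lemma real_induction (R : realType) (a b : R) (P : R -> Prop) :
  P a ->
  (forall t, a <= t < b -> P t ->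
     exists d, 0 < d /\ forall s, t < s < t + d -> s <= b -> P s) ->
  (forall t, a < t <= b -> (forall s, a <= s < t -> P s) -> P t) ->
  forall t, a <= t <= b -> P t.
Proof.
move=> Pa right left t0 /andP[at0 t0b].
have ab : a <= b by lra.
pose E := [set t | a <= t <= b /\ forall s, a <= s <= t -> P s].
have Ea : E a.
  split=> [|s sa]; first by rewrite lexx.
  by have -> : s = a by lra.
have ubE : ubound E b by move=> t [/andP[]].
have supE : has_sup E by split; [exists a | exists b].
set c := sup E.
have ac : a <= c by exact: sup_upper_bound.
have cb : c <= b by apply: ge_sup => //; exists a.
have Pltc s : a <= s < c -> P s.
  move=> /andP[as_ sc].
  have [t [tab Pt] st] := sup_adherent (eps := c - s) ltac:(lra) supE.
  apply: Pt; rewrite -/c in st; lra.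
have Pc : P c.
  have [->//|nac] := eqVneq c a.
  by apply: left => //; rewrite cb andbT lt_neqAle eq_sym nac.
have cEb : c = b.
  apply/eqP; rewrite eq_le cb /= leNgt; apply/negP => cltb.
  have [d [d0 Pd]] := right c ltac:(lra) Pc.
  pose t := c + Num.min d (b - c) / 2.
  have [m0 md mb] : [/\ 0 < Num.min d (b - c), Num.min d (b - c) <= d
      & Num.min d (b - c) <= b - c].
    by rewrite lt_min !ge_min !lexx orbT; split=> //; lra.
  have : E t.
    rewrite /t; split=> [|s /andP[as_ st]]; first lra.
    have [sc|] := ltP s c; first by apply: Pltc; lra.
    rewrite le_eqVlt => /predU1P[<-//|cs].
    by apply: Pd; lra.
  move/(sup_upper_bound supE); rewrite -/c /t; lra.
have [t0c|ct0] := ltP t0 c; first by apply: Pltc; lra.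
by have -> : t0 = c by lra.
Qed.

(** Continuity is relative to the interval because paths are total functions with arbitrary values
    outside it. *)
Definition path_continuous (R : realType) (V : normedModType R) (a b : R)
    (p : R -> V) :=
  forall t, a <= t <= b -> forall e, 0 < e -> exists d, 0 < d /\
    forall s, a <= s <= b -> `|s - t| < d -> `|p s - p t| < e.

(** With slope [C + e'] in place of [C], the bound propagates to the right by the Dini estimate and
    to left limits by continuity; then [e'] tends to 0. *)
Lemma dini_growth (R : realType) (a b C : R) (phi : R -> R) :
  path_continuous a b (phi : R -> R^o) ->
  (forall t, a <= t < b -> forall e, 0 < e -> exists d, 0 < d /\
     forall s, t < s < t + d -> s <= b -> phi s <= phi t + (C + e) * (s - t)) ->
  forall t, a <= t <= b -> phi t <= phi a + C * (t - a).
Proof.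
move=> cphi dphi t tab; apply/ler_addgt0Pr => e e0.
pose e' := e / (`|t - a| + 1).
have e'0 : 0 < e' by rewrite divr_gt0// ltr_wpDl.
have key : forall s, a <= s <= b -> phi s <= phi a + (C + e') * (s - a).
  apply: real_induction => [|s sab IH|s sab IH].
  - by rewrite subrr mulr0 addr0.
  - have [d [d0 Hd]] := dphi s sab _ e'0; exists d; split=> // s' ss' s'b.
    by have := Hd s' ss' s'b; nra.
  - apply/ler_addgt0Pr => h h0.
    (* One half of [h] pays for the variation of [phi] between [s - m / 2] and [s], the other for
       that of the affine bound; [h2] controls the latter. *)
    pose h' := h / 2; pose h2 := h' / (`|C + e'| + 1).
    have c0 : 0 < `|C + e'| + 1 by rewrite ltr_wpDl.
    have h20 : 0 < h2 by rewrite !divr_gt0.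
    have [d [d0 Hd]] := cphi s ltac:(lra) h' ltac:(rewrite /h'; lra).
    pose m := Num.min (Num.min d h2) (s - a).
    have [m0 md mh ms] : [/\ 0 < m, m <= d, m <= h2 & m <= s - a].
      by rewrite /m !lt_min !ge_min !lexx !orbT d0 h20; split=> //; lra.
    have := IH (s - m / 2) ltac:(lra).
    have := Hd (s - m / 2) ltac:(lra).
    rewrite (_ : s - m / 2 - s = - (m / 2)); last by ring.
    rewrite normrN ger0_norm; last by lra.
    move=> /(_ ltac:(lra)); rewrite ltr_norml => /andP[H1 _] H2.
    have H3 : (C + e') * (m / 2) >= - h'.
      have : `|(C + e') * (m / 2)| <= h'.
        rewrite normrM (@ger0_norm _ (m/2)); last by lra.
        have -> : h' = (`|C + e'| + 1) * h2 by rewrite /h2 mulrC divfK // gt_eqF.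
        apply: ler_pM => //; lra.
      by rewrite ler_norml => /andP[].
    rewrite /h' in H1 H3 *; lra.
apply: (le_trans (key t tab)).
have : e' * (t - a) <= e.
  rewrite /e' ger0_norm; last by lra.
  by rewrite mulrAC ler_pdivrMr; lra || nra.
lra.
Qed.

(** * Linear identities in modules, by reflection *)

Section ModuleTerms.
Context {K : comNzRingType} {V : lmodType K}.

Inductive lterm :=
| LVar of nat | LZero | LAdd of lterm & lterm | LOpp of lterm
| LScale of K & lterm.

Fixpoint leval (env : seq V) (t : lterm) : V :=
  match t with
  | LVar n => nth 0 env n
  | LZero => 0
  | LAdd u v => leval env u + leval env v
  | LOpp u => - leval env u
  | LScale c u => c *: leval env u
  end.

(** The bare [eqn] lets [cbn] reduce the test on variables, leaving coefficients that [ring]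
    understands. *)
Fixpoint lcoef (t : lterm) (i : nat) : K :=
  match t with
  | LVar n => if eqn n i then 1 else 0
  | LZero => 0
  | LAdd u v => lcoef u i + lcoef v i
  | LOpp u => - lcoef u i
  | LScale c u => c * lcoef u i
  end.

(** A recursive conjunction rather than a bounded quantifier, so that it unfolds into one [ring]
    goal per atom. *)
Fixpoint lterm_eq (n : nat) (t u : lterm) : Prop :=
  if n is m.+1 then lcoef t m = lcoef u m /\ lterm_eq m t u else True.

Lemma levalE env t :
  leval env t = \sum_(i < size env) lcoef t i *: nth 0 env i.
Proof.
elim: t => [n||u IHu v IHv|u IHu|c u IHu] /=.
- have E i : (if eqn n i then 1 else 0) = (n == i)%:R :> K by rewrite -eqnE; case: eqn.
  under eq_bigr do rewrite E.
  have [nlt|nge] := ltnP n (size env).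
    rewrite (bigD1 (Ordinal nlt)) //= eqxx scale1r big1 ?addr0// => i.
    by rewrite -val_eqE /= eq_sym => /negPf ->; exact: scale0r.
  rewrite nth_default// big1// => i _; rewrite gtn_eqF ?scale0r//.
  exact: leq_trans (ltn_ord i) nge.
- by rewrite big1// => i _; rewrite scale0r.
- by rewrite IHu IHv -big_split; apply: eq_bigr => i _; rewrite scalerDl.
- by rewrite IHu -sumrN; apply: eq_bigr => i _; rewrite scaleNr.
- by rewrite IHu scaler_sumr; apply: eq_bigr => i _; rewrite scalerA.
Qed.

Lemma lterm_eqP env t u : lterm_eq (size env) t u -> leval env t = leval env u.
Proof.
move=> tu; rewrite !levalE; apply: eq_bigr => -[i /= il] _; congr (_ *: _).
elim: (size env) il tu => // n IHn; rewrite ltnS leq_eqVlt => /predU1P[->|il] /= [] //.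
by move=> _; exact: IHn.
Qed.

End ModuleTerms.

(* Atoms are compared up to unification: the coercions in [f x] may be
   elaborated along different paths. *)
Ltac lmod_same a b :=
  match goal with
  | _ => let _ := match goal with _ => unify a b end in constr:(true)
  | _ => constr:(false)
  end.

Ltac lmod_env V e env :=
  lazymatch e with
  | @GRing.zero _ => env
  | @GRing.add _ ?a ?b => let env := lmod_env V a env in lmod_env V b env
  | @GRing.opp _ ?a => lmod_env V a env
  | @GRing.scale _ _ _ ?a => lmod_env V a env
  | _ =>
    let rec add l :=
      lazymatch l with
      | nil => constr:(@cons V e env)
      | cons ?x ?l' =>
        let r := lmod_same x e in
        lazymatch r with true => env | false => add l' end
      end in add env
  end.

Ltac lmod_reify K e env :=
  lazymatch e with
  | @GRing.zero _ => constr:(@LZero K)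
  | @GRing.add _ ?a ?b =>
    let a' := lmod_reify K a env in let b' := lmod_reify K b env in
    constr:(@LAdd K a' b')
  | @GRing.opp _ ?a => let a' := lmod_reify K a env in constr:(@LOpp K a')
  | @GRing.scale _ _ ?c ?a =>
    let a' := lmod_reify K a env in constr:(@LScale K c a')
  | _ =>
    let rec idx l :=
      lazymatch l with
      | cons ?x ?l' =>
        let r := lmod_same x e in
        lazymatch r with
        | true => constr:(0%N)
        | false => let n := idx l' in constr:(S n)
        end
      end in
    let n := idx env in constr:(@LVar K n)
  end.

(* Decides equalities of linear combinations in a module over [K] by comparing
   the coefficients with [ring]. *)
Ltac lmod K :=
  lazymatch goal with
  | |- @eq ?V ?a ?b =>
    let env := lmod_env V a (@nil V) in
    let env := lmod_env V b env in
    let a' := lmod_reify K a env in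
    let b' := lmod_reify K b env in
    apply: (@lterm_eqP _ _ env a' b');
    cbn [lterm_eq lcoef size eqn]; repeat split; ring
  end.

(** * Continuity of paths on an interval *)

Section PathContinuous.
Context {R : realType} {V W : normedModType R} (a b : R).
Implicit Types p q : R -> V.

Lemma lipschitz_path_continuous (L : R) p :
  (forall s t, a <= s <= b -> a <= t <= b -> `|p s - p t| <= L * `|s - t|) ->
  path_continuous a b p.
Proof.
move=> Lp t tab e e0.
have L1 : 0 < `|L| + 1 by rewrite ltr_wpDl.
exists (e / (`|L| + 1)); split=> [|s sab]; first by rewrite divr_gt0.
rewrite ltr_pdivlMr// => sd; apply: le_lt_trans sd.
by have := Lp s t sab tab; have := ler_norm L; have := normr_ge0 (s - t); nra.
Qed.

Lemma cst_path_continuous (x : V) : path_continuous a b (fun=> x).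
Proof. by move=> t _ e e0; exists 1; split=> // s _ _; rewrite subrr normr0. Qed.

Lemma segment_path_continuous (x v : V) :
  path_continuous a b (fun t : R => x + t *: v).
Proof.
apply: (@lipschitz_path_continuous `|v|) => s t _ _.
have -> : x + s *: v - (x + t *: v) = (s - t) *: v by lmod R.
by rewrite normrZ mulrC.
Qed.

Lemma path_continuous_comp (f : V -> W) p :
  continuous f -> path_continuous a b p -> path_continuous a b (f \o p).
Proof.
move=> cf cp t tab e e0.
have /cvgrPdist_lt/(_ e e0)/nbhs_normP[d /= d0 Hd] := cf (p t).
have [d' [d'0 Hd']] := cp t tab d d0.
exists d'; split=> // s sab st.
by rewrite distrC; apply: Hd; rewrite /ball_ /= distrC; exact: Hd'.
Qed.

Lemma path_continuousB p q : path_continuous a b p -> path_continuous a b q ->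
  path_continuous a b (fun t => p t - q t).
Proof.
move=> cp cq t tab e e0.
have e20 : 0 < e / 2 by lra.
have [d [d0 Hd]] := cp t tab _ e20; have [d' [d'0 Hd']] := cq t tab _ e20.
exists (Num.min d d'); split=> [|s sab]; rewrite lt_min ?d0// => /andP[sd sd'].
have -> : p s - q s - (p t - q t) = (p s - p t) - (q s - q t) by lmod R.
rewrite (le_lt_trans (ler_normB _ _))//.
by have := Hd s sab sd; have := Hd' s sab sd'; lra.
Qed.

Lemma path_continuous_norm p : path_continuous a b p ->
  path_continuous a b ((fun t => `|p t|) : R -> R^o).
Proof.
move=> cp t tab e e0; have [d [d0 Hd]] := cp t tab e e0.
exists d; split=> // s sab sd; apply: le_lt_trans (Hd s sab sd).
exact: ler_dist_dist.
Qed.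

End PathContinuous.

(** * Differentials in epsilon-delta form and strict differentiability *)

Section Differential.
Context {R : realType} {V W : normedModType R}.
Implicit Types (f : V -> W) (x z : V).

Lemma differentiable_dist f x : differentiable f x ->
  forall e : R, 0 < e -> exists d : R, 0 < d /\ forall z, `|z - x| < d ->
    `|f z - f x - 'd f x (z - x)| <= e * `|z - x|.
Proof.
move=> /diff_locally/eqaddoP Hf e e0.
have /nbhs_normP[d /= d0 Hd] := Hf e e0.
exists d; split=> // z zx.
have := Hd (z - x); rewrite /ball_ /= sub0r normrN => /(_ zx).
by rewrite /= !fctE /= subrK opprD addrA.
Qed.

Lemma dist_differentiable f (L : {linear V -> W}) x : continuous L ->
  (forall e : R, 0 < e -> exists d : R, 0 < d /\ forall z, `|z - x| < d ->
    `|f z - f x - L (z - x)| <= e * `|z - x|) ->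
  differentiable f x /\ 'd f x = L :> (V -> W).
Proof.
move=> cL Hf.
have H : f \o shift x = cst (f x) + L +o_ 0 id.
  apply/eqaddoP => e e0; have [d [d0 Hd]] := Hf e e0.
  apply/nbhs_normP; exists d => //= h; rewrite /ball_ /= sub0r normrN => hd.
  have := Hd (h + x); rewrite addrK => /(_ hd).
  by rewrite !fctE /= opprD addrA.
have dE : 'd f x = L :> (V -> W) by exact: diff_unique.
by split=> //; apply/diff_locallyP; rewrite dE.
Qed.

(** Mean value inequality for f - f'(x): along the segment from [z'] to [z] the deviation [q] has
    derivative (f' - f'(x)) v, of norm at most [e * |v|] near [x], and [dini_growth] integrates this
    for the norm of [q]. *)
Lemma C1_strict_differentiable f x : C1 f ->
  forall e : R, 0 < e -> exists d : R, 0 < d /\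
    forall z z', `|z - x| < d -> `|z' - x| < d ->
      `|f z - f z' - 'd f x (z - z')| <= e * `|z - z'|.
Proof.
move=> [df cdf] e e0; have [d [d0 Hd]] := cdf x e e0.
exists d; split=> // z z' zx z'x; pose v := z - z'.
pose q (t : R) := f (z' + t *: v) - (f z' + t *: 'd f x v).
have cq : path_continuous 0 1 q.
  apply: (@path_continuousB _ _ 0 1 (f \o fun t => z' + t *: v)); last first.
    exact: segment_path_continuous.
  apply: path_continuous_comp; last exact: segment_path_continuous.
  by move=> y; exact: differentiable_continuous.
suff : `|q 1| <= `|q 0| + e * `|v| * (1 - 0).
  rewrite /q !scale0r !addr0 subrr normr0 add0r !scale1r subr0 mulr1.
  by rewrite /v addrCA subrr addr0 opprD addrA.
apply: (@dini_growth R 0 1 (e * `|v|) (fun t => `|q t|)); first exact: path_continuous_norm; last by rewrite ler01 lexx.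
move=> t /andP[t0 t1] h h0.
pose h' := h / (`|v| + 1).
have h'0 : 0 < h' by rewrite divr_gt0// ltr_wpDl.
have h'v : h' * `|v| <= h.
  by rewrite /h' mulrAC ler_pdivrMr ?ltr_wpDl//; nra.
have [dl [dl0 Hdl]] := differentiable_dist (df (z' + t *: v)) h'0.
have dl'0 : 0 < dl / (`|v| + 1) by rewrite divr_gt0// ltr_wpDl.
exists (dl / (`|v| + 1)); split=> // s /andP[ts sd] s1.
pose w := (s - t) *: v.
have zE : z' + s *: v = z' + t *: v + w by rewrite /w; lmod R.
have wE : `|w| = (s - t) * `|v| by rewrite normrZ ger0_norm//; lra.
have wd : (s - t) * `|v| < dl.
  have : s - t < dl / (`|v| + 1) by lra.
  rewrite ltr_pdivlMr ?ltr_wpDl//; have := normr_ge0 v; nra.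
have := Hdl (z' + s *: v); rewrite zE [_ + w]addrC addrK wE => /(_ wd) H1.
(* Balls are convex, so the whole segment stays where f' is close to f'(x). *)
have ptd : `|z' + t *: v - x| < d.
  have -> : z' + t *: v - x = (1 - t) *: (z' - x) + t *: (z - x).
    by rewrite /v; lmod R.
  apply: (le_lt_trans (ler_normD _ _)); rewrite !normrZ !ger0_norm; try lra.
  nra.
have H2 := Hd _ ptd w.
(* The first increment is the Taylor remainder at the current point, the second the variation of f'
   between that point and [x]. *)
have -> : q s = q t + (f (w + (z' + t *: v)) - f (z' + t *: v) - 'd f (z' + t *: v) w)
   + ('d f (z' + t *: v) w - 'd f x w).
  have -> : 'd f x w = (s - t) *: 'd f x v by rewrite /w linearZ.
  by rewrite /q zE [w + _]addrC; lmod R.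
apply: (le_trans (ler_normD _ _)).
apply: (le_trans (lerD (ler_normD _ _) (lexx _))).
rewrite wE in H2; rewrite mulrDl.
have H3 : h' * ((s - t) * `|v|) <= h * (s - t).
  by rewrite mulrCA mulrC ler_wpM2r//; lra.
have H4 : e * ((s - t) * `|v|) = e * `|v| * (s - t) by ring.
rewrite [w + _]addrC in H1 *; lra.
Qed.

End Differential.

(** * Quantitative local inversion *)

Section LocalInverse.
Context {R : realType} {X Y : completeNormedModType R}.
Context {f : X -> Y} {g : X -> Y -> X}.
Hypothesis fC1 : C1 f.
Hypothesis gK : forall x, cancel ('d f x) (g x) /\ cancel (g x) ('d f x).
Hypothesis g_bounded : forall r : R, 0 < r -> exists M : R,
  forall x, `|x| <= r -> forall u, `|g x u| <= M * `|u|.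

Lemma inv_diff_linear x : linear (g x).
Proof.
move=> a u v; apply: (can_inj (gK x).1).
by rewrite linearP !(gK x).2.
Qed.

Lemma inv_diffB x u v : g x (u - v) = g x u - g x v.
Proof.
by rewrite addrC -scaleN1r inv_diff_linear scaleN1r addrC.
Qed.

Lemma inv_diff0 x : g x 0 = 0.
Proof. by have := inv_diffB x 0 0; rewrite !subrr. Qed.

Lemma inv_diffZ x a u : g x (a *: u) = a *: g x u.
Proof. by have := inv_diff_linear x a u 0; rewrite inv_diff0 !addr0. Qed.

(** Normal form of (ii): any real radius, and a positive constant by which one can divide. *)
Lemma inv_diff_bounded (r : R) : exists M : R, 0 < M /\
  forall x, `|x| <= r -> forall u, `|g x u| <= M * `|u|.
Proof.
have [M HM] := @g_bounded (`|r| + 1) ltac:(rewrite ltr_wpDl//).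
exists (`|M| + 1); split=> [|x xr u]; first by rewrite ltr_wpDl.
have := HM x _ u; have := ler_norm r; have := ler_norm M; have := normr_ge0 u.
by move=> u0 M1 r1 /(_ ltac:(lra)); nra.
Qed.

(** Strict differentiability makes [g x] composed with f a perturbation of the identity by a map of
    Lipschitz constant 1/2. This gives the Lipschitz bound on the inverse at once, and makes the
    simplified Newton map [T] a contraction whose fixed points solve f z = y. *)
Lemma local_inverse (x : X) : exists r rho L : R,
  [/\ 0 < r, 0 < rho, 0 < L,
    forall y, `|y - f x| < rho -> exists z, `|z - x| < r /\ f z = y
  & forall z z', `|z - x| < r -> `|z' - x| < r ->
      `|z - z'| <= L * `|f z - f z'|].
Proof.
have [M [M0 HM]] := inv_diff_bounded `|x|.
have {}HM := HM x (lexx _).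
have e0 : 0 < (2 * M)^-1 by rewrite invr_gt0; lra.
have [r [r0 Hr]] := C1_strict_differentiable x fC1 e0.
have Hg z z' : `|z - x| < r -> `|z' - x| < r ->
    `|g x (f z - f z') - (z - z')| <= `|z - z'| / 2.
  move=> zr z'r.
  rewrite -[z - z' in X in `|X|](gK x).1 -inv_diffB.
  apply: (le_trans (HM _)).
  have -> : `|z - z'| / 2 = M * ((2 * M)^-1 * `|z - z'|) by field; rewrite gt_eqF.
  by rewrite ler_pM2l// Hr.
(* The closed ball of radius [r1] lies in the open one of radius [r]. The choice of [rho] makes [T]
   move the centre by at most [r1 / 2]; the contraction adds at most [r1 / 2], so [T] preserves the
   closed ball. *)
pose r1 := r / 2; pose rho := r1 / (2 * M).
have rho0 : 0 < rho by rewrite !divr_gt0//; lra.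
exists r, rho, (2 * M); split=> // [|y yrho|z z' zr z'r]; first by lra.
  pose T z := z - g x (f z - y).
  pose U := closed_ball_ (Num.norm : X -> R) x r1.
  have Ur z : U z -> `|z - x| < r.
    by rewrite /U /closed_ball_ /r1 /= distrC => ?; lra.
  have Tlip z z' : U z -> U z' -> `|T z - T z'| <= `|z - z'| / 2.
    move=> /Ur zr /Ur z'r; have := Hg z z' zr z'r.
    have -> : g x (f z - f z') = g x (f z - y) - g x (f z' - y).
      by rewrite -inv_diffB; congr (g x _); lmod R.
    by rewrite distrC; congr (`|_| <= _); rewrite /T; lmod R.
  have Ux : U x by rewrite /U /closed_ball_ /= subrr normr0 /r1; lra.
  have TU : {homo T : z / U z >-> U z}.
    move=> z Uz; rewrite /U /closed_ball_ /=.
    have := Tlip x z Ux Uz; have : `|x - T x| <= r1 / 2.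
      rewrite /T opprB addrC subrK; apply: (le_trans (HM _)).
      rewrite distrC; move: yrho; rewrite /rho ltr_pdivlMr; lra.
    move: Uz; rewrite /U /closed_ball_ /= => Uz.
    by have := ler_distD (T x) x (T z); lra.
  have [|||z Uz] := @banach_fixed_point R X U (mkfun_fun TU).
  - exists (2^-1)%:nng; split=> /=; first by lra.
    by move=> [z z'] /= [Uz Uz']; rewrite mulrC; exact: Tlip.
  - exact: closed_closed_ball_.
  - by exists x.
  move=> zT; have zE : z = T z by exact: zT.
  exists z; split; first exact: Ur.
  have : g x (f z - y) = 0.
    have -> : g x (f z - y) = z - T z by rewrite /T; lmod R.
    by rewrite -zE subrr.
  move/(congr1 ('d f x)); rewrite (gK x).2 linear0 => /eqP.
  by rewrite subr_eq0 => /eqP.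
have := Hg z z' zr z'r; have := HM (f z - f z').
have := ler_distD (g x (f z - f z')) (z - z') 0.
rewrite !subr0 [`|z - z' - _|]distrC; lra.
Qed.

End LocalInverse.

(** * Gluing paths and extending them to an end point *)

Section PathGluing.
Context {R : realType}.
Implicit Types (V : normedModType R) (a b c : R).

Lemma path_continuousS V a b c d (p : R -> V) : a <= c -> d <= b ->
  path_continuous a b p -> path_continuous c d p.
Proof.
move=> ac db cp t tcd e e0; have [h [h0 Hh]] := cp t ltac:(lra) e e0.
by exists h; split=> // s scd; apply: Hh; lra.
Qed.

Lemma path_continuous_glue V a b c (p q : R -> V) :
  path_continuous a c p -> path_continuous c b q -> p c = q c ->
  path_continuous a b (fun u => if u <= c then p u else q u).
Proof.
move=> cp cq pqc t tab e e0.
have [tc|tc|tc] := ltgtP t c.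
- have [d [d0 Hd]] := cp t ltac:(lra) e e0.
  exists (Num.min d (c - t)); split=> [|s sab]; rewrite lt_min; first lra.
  move=> /andP[sd]; rewrite ltr_norml => /andP[_ sc].
  by rewrite ifT; [apply: Hd; lra|lra].
- have [d [d0 Hd]] := cq t ltac:(lra) e e0.
  exists (Num.min d (t - c)); split=> [|s sab]; rewrite lt_min; first lra.
  move=> /andP[sd]; rewrite ltr_norml => /andP[sc _].
  by rewrite leNgt ifF; [apply: Hd; lra|apply/negbTE; rewrite negbK; lra].
- subst t.
  have [d [d0 Hd]] := cp c ltac:(lra) e e0.
  have [d' [d'0 Hd']] := cq c ltac:(lra) e e0.
  exists (Num.min d d'); split=> [|s sab]; rewrite lt_min ?d0//.
  move=> /andP[sd sd']; have [sc|sc] := leP s c; first by apply: Hd; lra.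
  by rewrite pqc; apply: Hd'; lra.
Qed.

Lemma path_continuous_eq_end V a b (p q : R -> V) : a < b ->
  path_continuous a b p -> path_continuous a b q ->
  (forall t, a <= t < b -> p t = q t) -> p b = q b.
Proof.
move=> ab cp cq pq; apply/eqP; rewrite -subr_eq0 -normr_eq0 eq_le normr_ge0 andbT.
apply/ler_addgt0Pr => e e0; rewrite add0r.
have [d [d0 Hd]] := path_continuousB cp cq (t := b) ltac:(lra) e0.
pose s := Num.max a (b - d / 2).
have [sa sd sb] : [/\ a <= s, b - d / 2 <= s & s < b].
  by rewrite /s gt_max !le_max !lexx orbT; split=> //; lra.
have := Hd s ltac:(lra); rewrite pq ?sa// subrr sub0r normrN => H; apply: ltW; apply: H.
by rewrite ltr_norml; lra.
Qed.

(** The Lipschitz bound makes the values near [b] a Cauchy filter; completeness gives the limit, and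
    the bound passes to it. *)
Lemma lipschitz_left_limit (V : completeNormedModType R) a b (M : R)
  (q : R -> V) : a < b ->
  (forall s t, a <= s <= t -> t < b -> `|q s - q t| <= M * (t - s)) ->
  exists l, forall s, a <= s < b -> `|q s - l| <= M * (b - s).
Proof.
move=> ab qM.
have M0 : 0 <= M.
  have := qM a ((a + b) / 2) ltac:(lra) ltac:(lra).
  by have := normr_ge0 (q a - q ((a + b) / 2)); nra.
have : cvg (q @ b^'-).
  apply: cauchy_cvg; apply: cauchy_exP => e e0.
  pose s := Num.max a (b - e / (2 * (M + 1))).
  have h0 : 0 < e / (2 * (M + 1)) by rewrite divr_gt0//; lra.
  have [sa sd sb] : [/\ a <= s, b - e / (2 * (M + 1)) <= s & s < b].
    by rewrite /s gt_max !le_max !lexx orbT; split=> //; lra.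
  exists (q s); rewrite /fmapE -ball_normE /=.
  near=> t; rewrite /ball_ /=; apply: le_lt_trans (qM s t _ _) _.
  - by rewrite sa/=; near: t; exact: nbhs_left_ge.
  - by near: t; exact: nbhs_left_lt.
  - have tb : t < b by near: t; exact: nbhs_left_lt.
    have : (M + 1) * (e / (2 * (M + 1))) = e / 2 by field; lra.
    nra.
move=> /cvg_ex[l /= ql]; exists l => s /andP[as_ sb].
apply/ler_addgt0Pr => e e0.
have /cvgrPdist_lt/(_ e e0) Hl := ql.
near b^'- => t.
have lt : `|l - q t| < e by near: t.
have st : s <= t by near: t; exact: nbhs_left_ge.
have tb : t < b by near: t; exact: nbhs_left_lt.
have := ler_distD (q t) (q s) l; have := qM s t ltac:(lra) tb.
by rewrite [`|q t - l|]distrC; nra.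
Unshelve. all: by end_near. Qed.

End PathGluing.

(** * Existence, uniqueness and growth of lifted segments *)

Definition segment_lift (R : realType) (X Y : normedModType R) (f : X -> Y)
    (x : X) (w : Y) (T : R) (p : R -> X) :=
  [/\ path_continuous 0 T p, p 0 = x
    & forall t, 0 <= t <= T -> f (p t) = f x + t *: w].

Section SegmentLifting.
Context {R : realType} {X Y : completeNormedModType R}.
Context {f : X -> Y} {g : X -> Y -> X}.
Hypothesis fC1 : C1 f.
Hypothesis gK : forall x, cancel ('d f x) (g x) /\ cancel (g x) ('d f x).
Hypothesis g_bounded : forall r : R, 0 < r -> exists M : R,
  forall x, `|x| <= r -> forall u, `|g x u| <= M * `|u|.

Let f_continuous : continuous f.
Proof. by move=> x; apply: differentiable_continuous; exact: fC1.1. Qed.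

(** Agreement spreads to the right by local injectivity of f and to left limits by continuity. The
    paths are arbitrary because the proof of [cancel f sigma] lifts the image under f of a segment
    of [X], which is in general not a segment. *)
Lemma unique_lifting (a b : R) (p q : R -> X) :
  path_continuous a b p -> path_continuous a b q ->
  (forall t, a <= t <= b -> f (p t) = f (q t)) -> p a = q a ->
  forall t, a <= t <= b -> p t = q t.
Proof.
move=> cp cq fpq pqa; apply: real_induction => // t tab.
- move=> pqt.
  have [r [_ [L [r0 _ _ _ Hinj]]]] := local_inverse fC1 gK g_bounded (p t).
  have [d [d0 Hd]] := cp t ltac:(lra) r r0.
  have [d' [d'0 Hd']] := cq t ltac:(lra) r r0.
  exists (Num.min d d'); split=> [|s ts sb]; first by rewrite lt_min d0.
  have [sd sd'] : `|s - t| < d /\ `|s - t| < d'.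
    move: ts; rewrite -ltrBlDl lt_min => /andP[ts /andP[sd sd']].
    by rewrite ger0_norm; lra.
  have := Hinj (p s) (q s) (Hd s ltac:(lra) sd) _.
  rewrite {1}pqt => /(_ (Hd' s ltac:(lra) sd')).
  rewrite fpq; last lra.
  by rewrite subrr normr0 mulr0 normr_le0 subr_eq0 => /eqP.
- move=> IH; apply: (@path_continuous_eq_end _ _ a t) => //; first lra.
  + by apply: path_continuousS cp; lra.
  + by apply: path_continuousS cq; lra.
Qed.

Lemma segment_liftS x w T S p : S <= T ->
  segment_lift f x w T p -> segment_lift f x w S p.
Proof.
move=> ST [cp p0 fp]; split=> //; first by apply: path_continuousS cp.
by move=> t t01; apply: fp; lra.
Qed.

Lemma segment_lift_unique x w T p q :
  segment_lift f x w T p -> segment_lift f x w T q ->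
  forall t, 0 <= t <= T -> p t = q t.
Proof.
move=> [cp p0 fp] [cq q0 fq]; apply: unique_lifting => //; last by rewrite p0.
by move=> t tT; rewrite fp// fq.
Qed.

(** The increment of f along the lift is exactly [(s - t) *: w]. Expand f at [p t] and apply the
    inverse differential: the remainder is small against [|p s - p t|], itself at most
    [L * |w| * (s - t)] by local inversion. *)
Lemma segment_lift_velocity x w T p : segment_lift f x w T p ->
  forall t, 0 <= t < T -> forall e, 0 < e -> exists d, 0 < d /\
    forall s, t < s < t + d -> s <= T ->
      `|p s - p t - (s - t) *: g (p t) w| <= e * (s - t).
Proof.
move=> [cp p0 fp] t tT e e0.
have [r [_ [L [r0 _ L0 _ Hinj]]]] := local_inverse fC1 gK g_bounded (p t).
have [M [M0 HM]] := inv_diff_bounded g_bounded `|p t|.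
have {}HM := HM _ (lexx _).
have w1 : 0 < `|w| + 1 by rewrite ltr_wpDl.
pose e1 := e / (M * L * (`|w| + 1)).
have e10 : 0 < e1 by rewrite divr_gt0// !mulr_gt0.
have [d1 [d10 Hd1]] := differentiable_dist (fC1.1 (p t)) e10.
have [d [d0 Hd]] := cp t ltac:(lra) (Num.min r d1) ltac:(rewrite lt_min r0//).
exists d; split=> // s /andP[ts sd] sT.
have [sr sd1] : `|p s - p t| < r /\ `|p s - p t| < d1.
  apply/andP; rewrite -lt_min; apply: Hd; first lra.
  by rewrite ger0_norm; lra.
have fE : f (p s) - f (p t) = (s - t) *: w by rewrite !fp; [lmod R|lra|lra].
have := Hinj (p s) (p t) sr ltac:(by rewrite subrr normr0).
rewrite fE normrZ ger0_norm; last lra.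
move=> H1; have := Hd1 _ sd1; rewrite fE => H2.
have -> : p s - p t - (s - t) *: g (p t) w =
    - g (p t) ((s - t) *: w - 'd f (p t) (p s - p t)).
  by rewrite (inv_diffB gK) (gK _).1 (inv_diffZ gK) opprB.
rewrite normrN; apply: (le_trans (HM _)).
have eE : e = M * (e1 * (L * (`|w| + 1))).
  by rewrite /e1; field; rewrite !gt_eqF.
clearbody e1; rewrite eE.
rewrite -!mulrA ler_pM2l//; apply: (le_trans H2); rewrite ler_pM2l//.
apply: (le_trans H1); rewrite ler_pM2l// mulrC ler_wpM2r//; first lra.
by rewrite lerDl.
Qed.

Section Growth.
Context {k : X -> R} {C : R}.
Hypothesis k_lip : locally_lipschitz k.
Hypothesis k_coercive : coercive k.
Hypothesis k_growth : forall x w e, 0 < e -> exists d, 0 < d /\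
  forall h, 0 < h < d -> k (x + h *: g x w) <= k x + (C * `|w| + e) * h.

(** A substitute for the chain rule: [p s] is within o(s - t) of the point reached along the
    straight line of direction [g (p t) w]. The Lipschitz bound transfers this error to [k], and
    [k_growth] handles the straight line; each takes half of [e]. *)
Lemma segment_lift_growth x w T p : segment_lift f x w T p ->
  forall t, 0 <= t <= T -> k (p t) <= k x + C * `|w| * t.
Proof.
move=> lp t tT; have [cp p0 fp] := lp.
have := @dini_growth R 0 T (C * `|w|) (k \o p).
rewrite /= p0 => /(_ _ _ t tT); rewrite subr0; apply.
  by apply: path_continuous_comp => //; exact: k_coercive.1.
move=> {t tT} t tT e e0.
have [d [L [d0 HL]]] := k_lip (p t).
have L1 : 0 < `|L| + 1 by rewrite ltr_wpDl.
have [d1 [d10 Hd1]] := cp t ltac:(lra) d d0.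
have e20 : 0 < e / 2 by lra.
have [d2 [d20 Hd2]] := k_growth (p t) w e20.
have [d3 [d30 Hd3]] := segment_lift_velocity lp tT (divr_gt0 e20 L1).
pose v := g (p t) w.
have v1 : 0 < `|v| + 1 by rewrite ltr_wpDl.
pose d4 := d / (`|v| + 1); have d40 : 0 < d4 by rewrite divr_gt0.
exists (Num.min (Num.min d1 d2) (Num.min d3 d4)).
split=> [|s]; first by rewrite !lt_min d10 d20 d30.
rewrite -[s < _]ltrBlDl !lt_min => /and3P[ts /andP[sd1 sd2] /andP[sd3 sd4]] sT.
have ps : `|p s - p t| < d by apply: Hd1; [lra|rewrite ger0_norm; lra].
have pv : `|p t + (s - t) *: v - p t| < d.
  rewrite addrC addKr normrZ ger0_norm; last lra.
  move: sd4; rewrite /d4 ltr_pdivlMr//; have := normr_ge0 v; nra.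
have := HL _ _ ps pv; have := Hd2 (s - t) ltac:(lra).
have := Hd3 s ltac:(lra) sT; rewrite -/v.
have -> : p s - p t - (s - t) *: v = p s - (p t + (s - t) *: v) by lmod R.
set N := `|p s - _|; move=> H1 H2 H3.
have N0 : 0 <= N by exact: normr_ge0.
have H4 : L * N <= e / 2 * (s - t).
  have : L * N <= (`|L| + 1) * N by have := ler_norm L; nra.
  move=> /le_trans; apply.
  have -> : e / 2 * (s - t) = (`|L| + 1) * (e / 2 / (`|L| + 1) * (s - t)).
    by field; rewrite gt_eqF.
  by rewrite ler_pM2l.
have := ler_norm (k (p s) - k (p t + (s - t) *: v)); nra.
Qed.

(** The constant depends neither on the duration nor on the lift, so it survives the passage to the
    limit in the continuation argument. *)
Lemma segment_lift_lipschitz x w : exists M, 0 <= M /\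
  forall T p, T <= 1 -> segment_lift f x w T p ->
    forall s t, 0 <= s <= t -> t <= T -> `|p s - p t| <= M * (t - s).
Proof.
(* The extra 1 puts the values of [k] outside the ball of radius [r] strictly above its bound along
   any lift of duration at most 1. *)
have [r Hr] := k_coercive.2 (k x + `|C * `|w| | + 1).
have [M [M0 HM]] := inv_diff_bounded g_bounded r.
exists (M * `|w|); split=> [|T p T1 lp s t st tT].
  by rewrite mulr_ge0// ltW.
have pr u : 0 <= u <= T -> `|p u| <= r.
  move=> uT; rewrite leNgt; apply/negP => /ltW/Hr.
  have := segment_lift_growth lp uT; have := ler_norm (C * `|w|).
  have := normr_ge0 (C * `|w|); nra.
have [cp p0 fp] := lp.
have cps : path_continuous s T p by apply: path_continuousS cp => //; lra.
have := @dini_growth R s T (M * `|w|) (fun u => `|p u - p s|).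
move=> /(_ _ _ t ltac:(lra)); rewrite subrr normr0 add0r distrC; apply.
  apply: path_continuous_norm.
  by apply: path_continuousB => //; exact: cst_path_continuous.
move=> u uT e e0.
have [d [d0 Hd]] := segment_lift_velocity lp (t := u) ltac:(lra) e0.
exists d; split=> // h uh hT; have H1 := Hd h uh hT.
have -> : p h - p s = (p u - p s) + (h - u) *: g (p u) w
    + (p h - p u - (h - u) *: g (p u) w) by lmod R.
apply: (le_trans (ler_normD _ _)).
apply: (le_trans (lerD (ler_normD _ _) H1)).
rewrite normrZ ger0_norm; last lra.
have := HM (p u) (pr u ltac:(lra)) w; nra.
Qed.

Lemma segment_lift_exists x w : exists p, segment_lift f x w 1 p.
Proof.
have [M [M0 HM]] := segment_lift_lipschitz x w.
suff : forall T, 0 <= T <= 1 -> exists p, segment_lift f x w T p.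
  by apply; rewrite ler01 lexx.
apply: real_induction => [|t t01 [p lp]|t t01 IH].
- exists (fun=> x); split=> // [|t t0]; first exact: cst_path_continuous.
  by rewrite (_ : t = 0) ?scale0r ?addr0//; lra.
- have [r [rho [L [r0 rho0 L0 Hsurj Hinj]]]] :=
    local_inverse fC1 gK g_bounded (p t).
  have w1 : 0 < `|w| + 1 by rewrite ltr_wpDl.
  (* During this time the target moves by less than [rho], so it stays in the range of the local
     inverse. *)
  exists (rho / (`|w| + 1)); split=> [|s /andP[ts sd] s1].
    by rewrite divr_gt0.
  have [cp p0 fp] := lp.
  have : forall u, exists z, t <= u <= s -> `|z - p t| < r /\ f z = f x + u *: w.
    move=> u; have [tu|] := boolP (t <= u <= s); last by exists 0.
    have [|z Hz] := Hsurj (f x + u *: w); last by exists z.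
    rewrite fp; last lra.
    rewrite (_ : _ - _ = (u - t) *: w); last by lmod R.
    rewrite normrZ ger0_norm; last lra.
    have : u - t < rho / (`|w| + 1) by lra.
    by rewrite ltr_pdivlMr//; have := normr_ge0 w; nra.
  move=> /choice[q Hq].
  have tts : t <= t <= s by lra.
  exists (fun u => if u <= t then p u else q u); split=> [||u us].
  + apply: path_continuous_glue => //.
      apply: (@lipschitz_path_continuous _ _ _ _ (L * `|w|)) => u v us vs.
      have [ur fu] := Hq u us; have [vr fv] := Hq v vs.
      apply: (le_trans (Hinj _ _ ur vr)).
      rewrite fu fv (_ : _ - _ = (u - v) *: w); last by lmod R.
      by rewrite normrZ [`|u - v| * _]mulrC mulrA.
    have [qr fq] := Hq t tts.
    have := Hinj (p t) (q t) ltac:(by rewrite subrr normr0) qr.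
    rewrite fq fp; last lra.
    by rewrite subrr normr0 mulr0 normr_le0 subr_eq0 => /eqP.
  + by rewrite ifT//; lra.
  + have [ut|tu] := leP u t; first by apply: fp; lra.
    by apply: (Hq u _).2; lra.
- have : forall s, exists p, 0 <= s < t -> segment_lift f x w s p.
    move=> s; have [/IH[p lp]|] := boolP (0 <= s < t); first by exists p.
    by exists (fun=> 0).
  (* The lifts chosen for different durations agree by uniqueness, so the diagonal [q] is a lift on
     all of [[0, t)]. *)
  move=> /choice[F HF]; pose q s := F s s.
  have qE s s' : 0 <= s' <= s -> s < t -> q s' = F s s'.
    move=> s's st; apply: (@segment_lift_unique x w s' (F s') (F s)).
    - by apply: HF; lra.
    - by apply: (@segment_liftS _ _ s); [lra|apply: HF; lra].
    - lra.
  have qM u v : 0 <= u <= v -> v < t -> `|q u - q v| <= M * (v - u).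
    move=> uv vt; rewrite (@qE v u)//; apply: (HM v) => //; first lra.
    by apply: HF; lra.
  have t0 : 0 < t by lra.
  have [l Hl] := lipschitz_left_limit t0 qM.
  pose p s := if s < t then q s else l.
  have pM u v : 0 <= u <= v -> v <= t -> `|p u - p v| <= M * (v - u).
    move=> /[swap]; rewrite le_eqVlt => /predU1P[->|vt] uv.
      rewrite /p ltxx; have [ut|tu] := ltP u t; first by apply: Hl; lra.
      by rewrite subrr normr0 mulr_ge0//; lra.
    by rewrite /p !ifT//; [exact: qM|lra].
  have cp : path_continuous 0 t p.
    apply: (@lipschitz_path_continuous _ _ _ _ M) => u v ut vt.
    have [uv|vu] := leP u v.
      by rewrite ler0_norm ?opprB; [apply: pM; lra|lra].
    by rewrite distrC ger0_norm; [apply: pM; lra|lra].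
  have p_lt s : 0 <= s < t -> f (p s) = f x + s *: w.
    move=> st; rewrite /p ifT; last lra.
    by have [_ _ fF] := HF s st; apply: fF; lra.
  exists p; split=> //.
    have F0 : 0 <= (0 : R) < t by rewrite lexx.
    by rewrite /p t0 /q; have [_ ->] := HF 0 F0.
  move=> s /andP[s0]; rewrite le_eqVlt => /predU1P[->|st]; last by apply: p_lt; lra.
  have := @path_continuous_eq_end _ _ 0 t (f \o p) (fun u => f x + u *: w) t0.
  apply; [exact: path_continuous_comp|exact: segment_path_continuous|exact: p_lt].
Qed.

End Growth.
End SegmentLifting.

(** * Continuity and smoothness of the inverse *)

Section GlobalInverse.
Context {R : realType} {X Y : completeNormedModType R}.
Context {f : X -> Y} {g : X -> Y -> X}.
Hypothesis fC1 : C1 f.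
Hypothesis gK : forall x, cancel ('d f x) (g x) /\ cancel (g x) ('d f x).
Hypothesis g_bounded : forall r : R, 0 < r -> exists M : R,
  forall x, `|x| <= r -> forall u, `|g x u| <= M * `|u|.

Lemma segment_lift_end_continuous (a : X) (P : Y -> R -> X) :
  (forall y, segment_lift f a (y - f a) 1 (P y)) -> continuous (fun y => P y 1).
Proof.
move=> HP y.
pose Q t := forall e, 0 < e -> exists d, 0 < d /\
  forall y', `|y' - y| < d -> `|P y' t - P y t| < e.
suff : forall t, 0 <= t <= 1 -> Q t.
  move=> /(_ 1 ltac:(rewrite ler01 lexx//)) Q1.
  apply/cvgrPdist_lt => e e0; have [d [d0 Hd]] := Q1 e e0.
  apply/nbhs_normP; exists d => //= y'; rewrite /ball_ /= => yd.
  by rewrite distrC; apply: Hd; rewrite distrC.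
have [cp p0 fp] := HP y; set w := y - f a in fp.
(* Since [eta] depends on [t] alone, this serves the right step with [t1 = t] and the left step with
   [s = t]. *)
have local t : 0 <= t <= 1 -> exists eta, 0 < eta /\ forall t1 s,
    0 <= t1 <= s -> s <= 1 -> `|t1 - t| < eta -> `|s - t| < eta -> Q t1 -> Q s.
  move=> t01.
  have [r [rho [L [r0 rho0 L0 Hsurj Hinj]]]] :=
    local_inverse fC1 gK g_bounded (P y t).
  have w1 : 0 < `|w| + 1 by rewrite ltr_wpDl.
  have [d1 [d10 Hd1]] := cp t t01 (r / 2) ltac:(lra).
  (* Half of [rho] absorbs the displacement in time, the other half the change from [y] to [y']. *)
  pose d2 := rho / 2 / (`|w| + 1).
  have d20 : 0 < d2 by rewrite !divr_gt0.
  exists (Num.min d1 d2); split=> [|t1 s t1s s1]; first by rewrite lt_min d10.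
  rewrite !lt_min => /andP[t1d1 t1d2] /andP[sd1 sd2] Qt1 e e0.
  have [d3 [d30 Hd3]] := Qt1 (r / 2) ltac:(lra).
  exists (Num.min d3 (Num.min (rho / 2) (e / L))).
  split=> [|y']; first by rewrite !lt_min d30 !divr_gt0.
  rewrite !lt_min => /and3P[yd3 yrho ye].
  have [cp' p'0 fp'] := HP y'.
  have : forall u, exists z, t1 <= u <= s ->
      `|z - P y t| < r /\ f z = f a + u *: (y' - f a).
    move=> u; have [us|] := boolP (t1 <= u <= s); last by exists 0.
    have [|z Hz] := Hsurj (f a + u *: (y' - f a)); last by exists z.
    rewrite fp//.
    have -> : f a + u *: (y' - f a) - (f a + t *: w) =
        (u - t) *: w + u *: (y' - y) by rewrite /w; lmod R.
    have ud2 : `|u - t| < d2.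
      move: t1d2 sd2; rewrite !ltr_norml => /andP[? ?] /andP[? ?].
      by apply/andP; split; lra.
    apply: (le_lt_trans (ler_normD _ _)); rewrite !normrZ.
    move: ud2; rewrite /d2 ltr_pdivlMr// (@ger0_norm _ u); last lra.
    have := normr_ge0 (u - t); have := normr_ge0 (y' - y); nra.
  move=> /choice[q Hq].
  have t1t1s : t1 <= t1 <= s by rewrite lexx; lra.
  have sts : t1 <= s <= s by rewrite lexx andbT; lra.
  (* At time [t1] both paths lie in the ball where f is injective and have the same image, so they
     coincide from there on; this keeps [P y'] in the ball up to time [s]. *)
  have p's : P y' s = q s.
    apply: (@unique_lifting _ _ _ f g fC1 gK g_bounded t1 s (P y') q) => //.
    - by apply: path_continuousS cp'; lra.
    - apply: (@lipschitz_path_continuous _ _ _ _ (L * `|y' - f a|)) => u v us vs.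
      have [ur fu] := Hq u us; have [vr fv] := Hq v vs.
      apply: (le_trans (Hinj _ _ ur vr)).
      rewrite fu fv (_ : _ - _ = (u - v) *: (y' - f a)); last by lmod R.
      by rewrite normrZ [`|u - v| * _]mulrC mulrA.
    - by move=> u us; rewrite (Hq u us).2 fp'//; lra.
    - have [qr fq] := Hq t1 t1t1s.
      have p'r : `|P y' t1 - P y t| < r.
        apply: (le_lt_trans (ler_distD (P y t1) _ _)).
        by have := Hd3 y' yd3; have := Hd1 t1 ltac:(lra) t1d1; lra.
      have := Hinj _ _ p'r qr; rewrite fq fp'; last lra.
      by rewrite subrr normr0 mulr0 normr_le0 subr_eq0 => /eqP.
  have [qr fq] := Hq s sts.
  have psr : `|P y s - P y t| < r by have := Hd1 s ltac:(lra) sd1; lra.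
  rewrite p's; apply: (le_lt_trans (Hinj _ _ qr psr)).
  rewrite fq fp; last lra.
  have -> : f a + s *: (y' - f a) - (f a + s *: w) = s *: (y' - y).
    by rewrite /w; lmod R.
  have [s0 s1'] : 0 <= s /\ s <= 1 by lra.
  rewrite normrZ ger0_norm//.
  move: ye; rewrite ltr_pdivlMr// => /(le_lt_trans _); apply.
  by rewrite mulrC ler_pM2r// ler_piMl.
apply: real_induction => [e e0|t t01 Qt|t t01 IH].
- exists 1; split=> // y' _; have [_ -> _] := HP y'.
  by rewrite p0 subrr normr0.
- have [eta [eta0 Heta]] := local t ltac:(lra).
  exists eta; split=> // s /andP[ts sd] s1; apply: (Heta t s) => //; first lra.
    by rewrite subrr normr0.
  by rewrite ger0_norm; lra.
- have [eta [eta0 Heta]] := local t ltac:(lra).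
  pose t1 := Num.max 0 (t - eta / 2).
  have [t10 t1e t1t] : [/\ 0 <= t1, t - eta / 2 <= t1 & t1 < t].
    by rewrite /t1 gt_max !le_max !lexx orbT; split=> //; lra.
  apply: (Heta t1 t); [lra|lra| |by rewrite subrr normr0|by apply: IH; lra].
  by rewrite ler0_norm; lra.
Qed.

(** Local inversion makes [h] locally Lipschitz, so the remainder of f at [h y], pulled back by
    [g (h y)], is small against [|z - y|]. *)
Lemma C1_inverse (h : Y -> X) : (forall x, continuous (g x)) ->
  cancel f h -> cancel h f -> continuous h -> C1 h.
Proof.
move=> gc fK hK hc.
have h_near y e : 0 < e -> exists d, 0 < d /\
    forall z, `|z - y| < d -> `|h z - h y| < e.
  move=> e0; have /cvgrPdist_lt/(_ e e0)/nbhs_normP[d /= d0 Hd] := hc y.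
  by exists d; split=> // z zd; rewrite distrC; apply: Hd; rewrite /ball_ /= distrC.
have hdiff y : differentiable h y /\ 'd h y = g (h y) :> (Y -> X).
  pose G : {linear Y -> X} := HB.pack (g (h y))
    (GRing.isLinear.Build R Y X *:%R (g (h y)) (inv_diff_linear gK (h y))).
  apply: (@dist_differentiable _ _ _ h G); first exact: gc.
  move=> e e0; rewrite /G /=.
  have [r [_ [L [r0 _ L0 _ Hinj]]]] := local_inverse fC1 gK g_bounded (h y).
  have [M [M0 HM]] := inv_diff_bounded g_bounded `|h y|.
  have {}HM := HM _ (lexx _).
  have e10 : 0 < e / (M * L) by rewrite divr_gt0// mulr_gt0.
  have [d1 [d10 Hd1]] := differentiable_dist (fC1.1 (h y)) e10.
  have [d [d0 Hd]] := h_near y (Num.min r d1) ltac:(rewrite lt_min r0//).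
  exists d; split=> // z /Hd; rewrite lt_min => /andP[zr zd1].
  have := Hinj (h z) (h y) zr ltac:(by rewrite subrr normr0); rewrite !hK => H1.
  have := Hd1 _ zd1; rewrite !hK => H2.
  have -> : h z - h y - g (h y) (z - y) =
      - g (h y) (z - y - 'd f (h y) (h z - h y)).
    by rewrite [in RHS](inv_diffB gK) (gK _).1 opprB.
  rewrite normrN; apply: (le_trans (HM _)).
  have -> : e * `|z - y| = M * (e / (M * L) * (L * `|z - y|)).
    by field; rewrite !gt_eqF.
  by rewrite ler_pM2l//; apply: (le_trans H2); rewrite ler_pM2l.
split=> [y|y e e0]; first exact: (hdiff y).1.
(* The margin 1 lets the same [M] bound the inverse differentials at [h y] and at all nearby
   [h z]. *)
have [M [M0 HM]] := inv_diff_bounded g_bounded (`|h y| + 1).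
have e10 : 0 < e / (M * M) by rewrite divr_gt0// mulr_gt0.
have [d1 [d10 Hd1]] := fC1.2 (h y) _ e10.
have [d [d0 Hd]] := h_near y (Num.min 1 d1) ltac:(rewrite lt_min ltr01//).
exists d; split=> // z /Hd; rewrite lt_min => /andP[z1 zd1] u.
rewrite (hdiff z).2 (hdiff y).2.
have hyM : `|h y| <= `|h y| + 1 by rewrite lerDl.
have hzM : `|h z| <= `|h y| + 1.
  by rewrite -[h z](subrK (h y)) addrC (le_trans (ler_normD _ _))// lerD2l ltW.
(* Resolvent identity: A^-1 - B^-1 = - A^-1 (A - B) B^-1. *)
have -> : g (h z) u - g (h y) u =
    - g (h z) ('d f (h z) (g (h y) u) - 'd f (h y) (g (h y) u)).
  by rewrite [in RHS](inv_diffB gK) (gK _).1 (gK _).2 opprB.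
rewrite normrN; apply: (le_trans (HM _ hzM _)).
have -> : e * `|u| = M * (e / (M * M) * (M * `|u|)) by field; rewrite gt_eqF.
rewrite ler_pM2l//; apply: (le_trans (Hd1 _ zd1 _)).
by rewrite ler_pM2l// HM.
Qed.

End GlobalInverse.

(** * From right directional derivatives to growth estimates, and the case of k in C^1 *)

Section DirectionalDerivatives.
Context {R : realType} {X Y : completeNormedModType R}.
Context {f : X -> Y} {g : X -> Y -> X}.
Hypothesis gK : forall x, cancel ('d f x) (g x) /\ cancel (g x) ('d f x).

(** By homogeneity, a step [h] in direction [w] is a step [h * |w|] in a unit direction, where (iii)
    applies; the tolerance [e / |w|] then contributes [e * h]. *)
Lemma rdd_growth (k : X -> R) (C : R) : (forall x v, has_rdd k x v) ->
  (forall x u, `|u| = 1 -> rdd k x (g x u) <= C) ->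
  forall x w e, 0 < e -> exists d, 0 < d /\
    forall h, 0 < h < d -> k (x + h *: g x w) <= k x + (C * `|w| + e) * h.
Proof.
move=> kr kC x w e e0.
have [->|w0] := eqVneq w 0.
  exists 1; split=> // h h01; rewrite (inv_diff0 gK) scaler0 addr0 normr0.
  by rewrite mulr0 add0r lerDl mulr_ge0//; lra.
have nw0 : 0 < `|w| by rewrite normr_gt0.
pose u := `|w|^-1 *: w.
have u1 : `|u| = 1 by rewrite normrZ normfV normr_id mulVf// gt_eqF.
have wE : w = `|w| *: u by rewrite scalerA mulfV ?gt_eqF// scale1r.
have e10 : 0 < e / `|w| by rewrite divr_gt0.
have [l kl] := kr x (g x u).
have lC : l <= C.
  by rewrite -(cvg_lim (@Rhausdorff R) kl); exact: kC.
have /cvgrPdist_lt/(_ _ e10)/nbhs_normP[d /= d0 Hd] := kl.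
exists (d / `|w|); split=> [|h /andP[h0 hd]]; first by rewrite divr_gt0.
pose s := h * `|w|.
have s0 : 0 < s by rewrite mulr_gt0.
have sd : s < d by move: hd; rewrite ltr_pdivlMr.
have := Hd s; rewrite /ball_ /= sub0r normrN gtr0_norm// => /(_ sd s0).
rewrite distrC => /ltr_normlW; rewrite /rdq ltrBlDl ltr_pdivrMr// => H.
rewrite {1}wE (inv_diffZ gK) scalerA -/s.
have : (l + e / `|w|) * s <= (C * `|w| + e) * h.
  have -> : (l + e / `|w|) * s = (l * `|w| + e) * h.
    by rewrite /s; field; rewrite gt_eqF.
  by rewrite ler_pM2r// lerD2r ler_pM2r.
lra.
Qed.

Lemma differentiable_rdd (k : X -> R) (x v : X) : differentiable k x ->
  rdd k x v = 'd k x v.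
Proof.
move=> dk; rewrite /rdd; apply: cvg_lim; first exact: Rhausdorff.
apply/cvgrPdist_le => e e0.
have v1 : 0 < `|v| + 1 by rewrite ltr_wpDl.
have [d [d0 Hd]] := differentiable_dist dk (divr_gt0 e0 v1).
apply/nbhs_normP; exists (d / (`|v| + 1)); first by rewrite /= divr_gt0.
move=> s; rewrite /ball_ /= sub0r normrN => sd s0.
move: sd; rewrite gtr0_norm// ltr_pdivlMr// => sd.
have := Hd (x + s *: v); rewrite [x + _]addrC addrK normrZ gtr0_norm//.
move=> /(_ ltac:(nra)); rewrite linearZ /= => H.
have -> : 'd k x v - rdq k x v s = - (k (s *: v + x) - k x - s * 'd k x v) / s.
  by rewrite /rdq [x + _]addrC; field; rewrite gt_eqF.
rewrite normrM normrN normfV (gtr0_norm s0) ler_pdivrMr//.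
apply: (le_trans H); rewrite [s * _]mulrC mulrA ler_pM2r//.
by rewrite mulrAC ler_pdivrMr// ler_pM2l// lerDl.
Qed.

(** For differentiable [k] the right derivative is linear in the direction, so the one-sided bound
    applied to both [v] and [- v] bounds the absolute value. *)
Lemma C1_rdd_bounded_iff (k : X -> R) : C1 k ->
  (exists C : R, forall x u, `|u| = 1 -> rdd k x (g x u) <= C) <->
  (exists C : R, forall x u, `|'d k x (g x u)| <= C * `|u|).
Proof.
move=> [dk _]; split=> -[C HC]; exists C => x u.
- have [->|u0] := eqVneq u 0.
    by rewrite (inv_diff0 gK) linear0 !normr0 mulr0.
  have nu0 : 0 < `|u| by rewrite normr_gt0.
  have H v : `|v| = 1 -> 'd k x (g x v) <= C.
    by move=> /(HC x); rewrite differentiable_rdd.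
  pose v := `|u|^-1 *: u.
  have v1 : `|v| = 1 by rewrite normrZ normfV normr_id mulVf// gt_eqF.
  rewrite {1}(_ : u = `|u| *: v); last first.
    by rewrite scalerA mulfV ?gt_eqF// scale1r.
  rewrite (inv_diffZ gK) linearZ /= normrM normr_id mulrC ler_pM2r//.
  rewrite ler_norml H// andbT lerNl.
  have := H (- v); rewrite normrN => /(_ v1).
  by rewrite -sub0r (inv_diffB gK) (inv_diff0 gK) sub0r linearN.
- move=> u1; rewrite differentiable_rdd//; apply: (le_trans (ler_norm _)).
  by have := HC x u; rewrite u1 mulr1.
Qed.

End DirectionalDerivatives.

Theorem theorem3p1 (R : realType) (X Y : completeNormedModType R)
  (f : X -> Y) (g : X -> Y -> X) :
  C1 f ->
  (* (i) f'(x) in Isom(X;Y), with inverse g x *)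
  (forall x, cancel ('d f x) (g x) /\ cancel (g x) ('d f x) /\ continuous (g x)) ->
  (* (ii) sup_{|x| <= r} |f'(x)^-1| < +oo *)
  (forall r : R, 0 < r -> exists M : R,
     forall x, `|x| <= r -> forall u, `|g x u| <= M * `|u|) ->
  (forall k : X -> R,
     (* (iii) *)
     (forall x, 0 <= k x) -> locally_lipschitz k -> coercive k ->
     (forall x v, has_rdd k x v) ->
     (exists C : R, forall x u, `|u| = 1 -> rdd k x (g x u) <= C) ->
     global_diffeo f) /\
  (* remark: for k in C^1, the sup condition of (iii) is equivalent to
     sup_x |k'(x) o f'(x)^-1| < +oo *)
  (forall k : X -> R, C1 k ->
     ((exists C : R, forall x u, `|u| = 1 -> rdd k x (g x u) <= C) <->
      (exists C : R, forall x u, `|'d k x (g x u)| <= C * `|u|))).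
Proof.
move=> fC1 g_inv g_bounded.
have gK x : cancel ('d f x) (g x) /\ cancel (g x) ('d f x).
  by have [? []] := g_inv x.
split=> [k _ k_lip k_coercive kr [C kC]|k]; last exact: C1_rdd_bounded_iff.
have : forall y, exists p, segment_lift f 0 (y - f 0) 1 p.
  move=> y; apply: (segment_lift_exists fC1 gK g_bounded k_lip k_coercive).
  exact: rdd_growth kC.
move=> /choice[P HP]; pose sigma y := P y 1.
have sigmaK : cancel sigma f.
  move=> y; have [_ _ ->] := HP y; last by rewrite ler01 lexx.
  by rewrite scale1r addrC subrK.
have sigma_cont : continuous sigma.
  exact: (segment_lift_end_continuous fC1 gK g_bounded HP).
have f_cont : continuous f.
  by move=> x; apply: differentiable_continuous; exact: fC1.1.
have fK : cancel f sigma.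
  move=> x.
  pose q (t : R) : X := 0 + t *: x.
  have cq : path_continuous 0 1 q by exact: segment_path_continuous.
  have cp : path_continuous 0 1 (sigma \o (f \o q)).
    by do 2?apply: path_continuous_comp.
  have := unique_lifting fC1 gK g_bounded cp cq _ _ (t := 1).
  rewrite /= /q !add0r scale1r; apply.
  - by move=> t _; rewrite sigmaK.
  (* Common origin: for y = f 0 the segment is constant, so its lift from 0 is the constant path. *)
  - rewrite scale0r /sigma.
    have lift0 : segment_lift f 0 (f 0 - f 0) 1 (fun=> 0).
      split=> // [|t _]; first exact: cst_path_continuous.
      by rewrite subrr scaler0 addr0.
    apply: (segment_lift_unique fC1 gK g_bounded (HP (f 0)) lift0).
    by rewrite ler01 lexx.
  - by rewrite ler01 lexx.
split=> //; exists sigma; split=> //; split=> //.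
by apply: (C1_inverse fC1 gK g_bounded) => // x; have [_ []] := g_inv x.
Qed.
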